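(* Let $\lambda,\mu\in DP$ with $D_\mu\subseteq D_\lambda$, let $2\le a\le \ell(\mu)+2$ and $b\ge \ell(\lambda)$. Let $\Gamma^{\rightarrow}_a(D_{\lambda/\mu})$ be the diagram obtained from $D_{\lambda/\mu}$ by shifting all boxes above the $a$-th row (i.e. boxes $(x,y)$ with $x<a$) one box to the right, and let $\Gamma^{\downarrow}_b(D_{\lambda/\mu})$ be the diagram obtained from $D_{\lambda/\mu}$ by shifting all boxes $(x,y)$ with $y<b$ one box down. Let $\alpha,\beta,\tilde\alpha,\tilde\beta\in DP$ be such that $\Gamma^{\rightarrow}_a(D_{\lambda/\mu})$ has shape $D_{\alpha/\beta}$ and $\Gamma^{\downarrow}_b(D_{\lambda/\mu})$ has shape $D_{\tilde\alpha/\tilde\beta}$. Then for every $\nu\in DP$ $$f^{\lambda}_{\mu\nu}\le f^{\alpha}_{\beta\nu}\quad\text{and}\quad f^{\lambda}_{\mu\nu}\le f^{\tilde\alpha}_{\tilde\beta\nu}.$$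
   Context: $DP$ is the set of all partitions with distinct parts, i.e. finite strictly decreasing sequences $\lambda=(\lambda_1>\cdots>\lambda_{\ell(\lambda)}>0)$ of integers, including $\emptyset$. The (shifted) diagram is $D_\lambda=\{(i,j)\mid 1\le i\le \ell(\lambda),\ i\le j\le i+\lambda_i-1\}$ (matrix coordinates: first coordinate is the row, counted downwards); if $D_\mu\subseteq D_\lambda$, $D_{\lambda/\mu}=D_\lambda\setminus D_\mu$. A set of boxes has shape $D_{\alpha/\beta}$ if it equals $D_{\alpha/\beta}$ up to a translation. Alphabet: $1'<1<2'<2<\cdots$. A tableau of shape $D_{\lambda/\mu}$ is a filling of the boxes by letters of this alphabet, weakly increasing along rows (left to right) and down columns, such that each column contains at most one unmarked $k$ and each row at most one marked $k'$, for every $k\ge 1$. Its content $c(T)=(c_1,c_2,\ldots)$ (trailing zeros omitted) has $c_i$ = total number of entries $i$ and $i'$. Amenability: the reading word $w(T)$ reads the rows from left to right, starting with the bottom row and ending with the top row. For a word $w=w_1\cdots w_n$ in the alphabet and $i\ge1$ set $m_i(0)=0$; for $1\le j\le n$, $m_i(j)$ is the number of letters $i$ in $w_{n-j+1}\cdots w_n$; for $n+1\le j\le 2n$, $m_i(j)=m_i(n)+$ the number of letters $i'$ in $w_1\cdots w_{j-n}$. The word is $k$-amenable if: (a) for $0\le j\le n-1$, if $m_k(j)=m_{k-1}(j)$ then $w_{n-j}\notin\{k,k'\}$; (b) for $n\le j\le 2n-1$, if $m_k(j)=m_{k-1}(j)$ then $w_{j-n+1}\notin\{k-1,k'\}$;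 (c) the leftmost letter of $w$ in $\{k',k\}$, if any, is $k$; (d) the leftmost letter of $w$ in $\{(k-1)',k-1\}$, if any, is $k-1$. The word is amenable if it is $k$-amenable for all $k>1$; a tableau is amenable if its reading word is. $f^\lambda_{\mu\nu}$ is the number of amenable tableaux of shape $D_{\lambda/\mu}$ and content $\nu$. *)

(* Defs.v *)
From mathcomp Require Import all_boot all_order all_algebra finmap.
From mathcomp Require Import boolp classical_sets functions cardinality.

Set Implicit Arguments.
Unset Strict Implicit.
Unset Printing Implicit Defensive.

Local Open Scope nat_scope.

Definition is_DP (la : seq nat) : bool := sorted gtn la && (0 \notin la).

(* A box (row, column); rows are numbered downwards, both coordinates of the
   boxes of a diagram start at 1. *)
Definition box : Type := nat * nat.

Definition diagram (la : seq nat) : seq box :=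
  [seq (i.+1, i.+1 + j) | i <- iota 0 (size la), j <- iota 0 (nth 0 la i)].

Definition contained (mu la : seq nat) : Prop :=
  {subset diagram mu <= diagram la}.

Definition skew (la mu : seq nat) : seq box :=
  [seq b <- diagram la | b \notin diagram mu].

Definition translate (t : int * int) (D : seq box) : seq (int * int) :=
  [seq (b.1%:Z + t.1, b.2%:Z + t.2)%R | b <- D].

Definition has_shape (D : seq box) (al be : seq nat) : Prop :=
  contained be al /\
  exists t : int * int, translate (0, 0)%R D =i translate t (skew al be).

(* The coercion from bool to nat adds 1 exactly to the boxes being moved. *)
Definition shift_right (a : nat) (D : seq box) : seq box :=
  [seq (b.1, b.2 + (b.1 < a)) | b <- D].

Definition shift_down (b : nat) (D : seq box) : seq box :=
  [seq (c.1 + (c.2 < b), c.2) | c <- D].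

(* (k, false) is the letter k and (k, true) is the marked letter k'; only the
   letters with 0 < k belong to the alphabet 1' < 1 < 2' < 2 < ... *)
Definition letter : Type := nat * bool.

Definition letter_le (x y : letter) : bool :=
  (x.1 < y.1) || ((x.1 == y.1) && (y.2 ==> x.2)).

Definition filling (D : seq box) : Type := {ffun seq_sub D -> letter}.

Definition is_tableau (D : seq box) (T : filling D) : Prop :=
  [/\ forall c, 0 < (T c).1,
      forall c d : seq_sub D, (val c).1 = (val d).1 ->
        (val c).2 <= (val d).2 -> letter_le (T c) (T d),
      forall c d : seq_sub D, (val c).2 = (val d).2 ->
        (val c).1 <= (val d).1 -> letter_le (T c) (T d),
      forall k (c d : seq_sub D), (val c).2 = (val d).2 ->
        T c = (k, false) -> T d = (k, false) -> c = d &
      forall k (c d : seq_sub D), (val c).1 = (val d).1 ->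
        T c = (k, true) -> T d = (k, true) -> c = d].

Definition reading_le (c d : box) : bool :=
  (d.1 < c.1) || ((c.1 == d.1) && (c.2 <= d.2)).

Definition reading_word (D : seq box) (T : filling D) : seq letter :=
  [seq T c | c <- sort (relpre val reading_le) (enum {: seq_sub D})].

(* The last entry is nonzero, since the largest index of a letter occurs. *)
Definition content (D : seq box) (T : filling D) : seq nat :=
  let w := reading_word T in
  mkseq (fun i => count [pred x : letter | x.1 == i.+1] w) (\max_(x <- w) x.1).

(* m_i(j) for 0 <= j <= 2n. *)
Definition mstat (w : seq letter) (i j : nat) : nat :=
  let n := size w in
  if j <= n then count_mem (i, false) (drop (n - j) w)
  else count_mem (i, false) w + count_mem (i, true) (take (j - n) w).

Definition leftmost_unmarked (w : seq letter) (k : nat) : Prop :=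
  forall x, ohead [seq y <- w | y.1 == k] = Some x -> x = (k, false).

(* The r-th letter w_r of the word is nth (0, false) w r.-1. *)
Definition k_amenable (w : seq letter) (k : nat) : Prop :=
  let n := size w in
  [/\ forall j, j < n -> mstat w k j = mstat w k.-1 j ->
        nth (0, false) w (n - j).-1 \notin [:: (k, false); (k, true)],
      forall j, n <= j < n.*2 -> mstat w k j = mstat w k.-1 j ->
        nth (0, false) w (j - n) \notin [:: (k.-1, false); (k, true)],
      leftmost_unmarked w k &
      leftmost_unmarked w k.-1].

Definition amenable (w : seq letter) : Prop := forall k, 1 < k -> k_amenable w k.

Definition amenable_tableaux (D : seq box) (nu : seq nat) : set (filling D) :=
  [set T | [/\ is_tableau T, amenable (reading_word T) & content T = nu]]%classic.

Lemma mem_reading_word (D : seq box) (T : filling D) c : T c \in reading_word T.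
Proof. by rewrite map_f // mem_sort mem_enum. Qed.

(* fset_set sends infinite sets to the empty one; this does not occur here. *)
Lemma finite_amenable_tableaux (D : seq box) (nu : seq nat) :
  finite_set (@amenable_tableaux D nu).
Proof.
pose F := {ffun seq_sub D -> 'I_(size nu).+1 * bool}.
pose g (S : F) : filling D := [ffun c => (nat_of_ord (S c).1, (S c).2)].
apply: (@sub_finite_set _ _ [set g S | S in [set: F]]%classic); last first.
  exact/finite_image/finite_finset.
move=> T [_ _ cT]; exists [ffun c => (inord (T c).1, (T c).2)] => //.
apply/ffunP => c; rewrite !ffunE /= inordK; first by case: (T c).
rewrite ltnS -cT size_mkseq.
exact: (@leq_bigmax_seq _ _ xpredT fst _ (mem_reading_word T c)).
Qed.

(* fcoef la mu nu is the coefficient f^la_(mu nu). *)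
Definition fcoef (la mu nu : seq nat) : nat :=
  #|` fset_set (@amenable_tableaux (skew la mu) nu)|%fset.

(* Main.v *)
(* Shift the entries of a tableau together with their boxes.  If two boxes which
   were in different columns (resp. rows) come to lie in one column (resp. row),
   then the corner between them is a box as well, and comparison with the entry
   there shows that the new filling is a tableau.  Moving boxes to the right does
   not change the reading word.  Moving down the boxes to the left of column [b]
   exchanges, in the reading word, the right part of each row with the left part
   of the row above it, where all indices are smaller.  Only the condition on the
   first scan for [k] can suffer, when a [k] or [k'] in the lower row loses some
   [k-1] on the left of the upper row; but then the boxes above this [k] and
   above the following ones contain [k-1] or, once at most, [k'], and these
   suffice to keep the number of [k-1] ahead of the number of [k]. *)
Require Import Defs.
From mathcomp Require Import all_boot ssralg ssrint finmap zify.
From mathcomp Require Import boolp classical_sets cardinality.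

Set Implicit Arguments.
Unset Strict Implicit.
Unset Printing Implicit Defensive.

Local Open Scope nat_scope.

(** * Amenability through counts in suffixes and prefixes of a word *)

Lemma mstat_suffix (u v : seq letter) l :
  mstat (u ++ v) l (size v) = count_mem (l, false) v.
Proof. by rewrite /mstat size_cat leq_addl addnK drop_size_cat. Qed.

Lemma mstat_prefix (u v : seq letter) l :
  mstat (u ++ v) l (size (u ++ v) + size u) =
  count_mem (l, false) (u ++ v) + count_mem (l, true) u.
Proof.
rewrite /mstat; case: leqP => h; last by rewrite addKn take_size_cat.
(* The first branch of [mstat] is taken only for empty [u], where both formulas agree. *)
have /size0nil -> : size u = 0 by lia.
by rewrite !addn0 subnn drop0.
Qed.

(** Grow the suffix to the left one letter at a time: only a new [k] could break the inequality, and
    only from equality, where condition (a) excludes it. *)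
Lemma k_amenable_suffix (w : seq letter) k : 0 < k -> k_amenable w k ->
  forall u v, w = u ++ v -> count_mem (k, false) v <= count_mem (k.-1, false) v.
Proof.
move=> k0 [Ha _ _ _] u v; elim: v u => // x v IH u Ew.
have := IH (rcons u x); rewrite cat_rcons => /(_ Ew) le.
have ms i : mstat w i (size v) = count_mem (i, false) v.
  by rewrite Ew -cat_rcons mstat_suffix.
have := Ha (size v); rewrite !ms Ew size_cat /= addnS ltnS leq_addl.
rewrite subSn ?leq_addl // addnK nth_cat ltnn subnn /= => /(_ isT).
rewrite !inE => x_neq.
move: le; rewrite leq_eqVlt => /predU1P[e|lt].
  by move: (x_neq e); rewrite negb_or e => /andP[/negPf -> _]; exact: leq_addl.
apply: leq_trans (leq_addl _ _); apply: leq_trans lt.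
by rewrite -add1n leq_add2r leq_b1.
Qed.

(** The same argument for the second scan: it starts from the inequality for the whole word, and at
    equality condition (b) excludes the next letter [k']. *)
Lemma k_amenable_prefix (w : seq letter) k : 0 < k -> k_amenable w k ->
  forall u v, w = u ++ v ->
  count_mem (k, false) w + count_mem (k, true) u <=
  count_mem (k.-1, false) w + count_mem (k.-1, true) u.
Proof.
move=> k0 kw; have [_ Hb _ _] := kw; elim/last_ind => [|u x IH] v Ew.
  by rewrite !addn0; apply: (k_amenable_suffix k0 kw (u := [::])).
move: Ew; rewrite cat_rcons => Ew; have le := IH _ Ew.
have ms i : mstat w i (size w + size u) =
    count_mem (i, false) w + count_mem (i, true) u.
  by rewrite {1 2}Ew mstat_prefix -Ew.
have := Hb (size w + size u); rewrite !ms.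
have -> : size w <= size w + size u < (size w).*2.
  by rewrite Ew size_cat /=; lia.
rewrite addKn => /(_ isT); rewrite {3}Ew nth_cat ltnn subnn /= !inE.
rewrite -cats1 !count_cat /= !addn0 !addnA.
move: le; rewrite leq_eqVlt => /predU1P[e /(_ e)|lt _].
  by rewrite negb_or => /andP[_ /negPf ->]; rewrite e addn0 leq_addr.
apply: leq_trans (leq_addr _ _); apply: leq_trans lt.
by rewrite -addn1 leq_add2l leq_b1.
Qed.

(** The weak inequalities hold throughout, so forbidding a letter at equality amounts to strict
    inequality at that letter. Unlike equalities, these can be carried over by comparing sets. *)
Lemma k_amenableP (w : seq letter) k : 0 < k ->
  k_amenable w k <->
  [/\ forall u x v, w = u ++ x :: v -> x.1 = k ->
        count_mem (k, false) v < count_mem (k.-1, false) v,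
      forall u x v, w = u ++ x :: v -> x \in [:: (k.-1, false); (k, true)] ->
        count_mem (k, false) w + count_mem (k, true) u <
        count_mem (k.-1, false) w + count_mem (k.-1, true) u,
      leftmost_unmarked w k &
      leftmost_unmarked w k.-1].
Proof.
move=> k0; split=> [kw|[Ha Hb Hc Hd]].
  have [Ha Hb Hc Hd] := kw; split=> // u x v Ew.
    move=> xk; have le := k_amenable_suffix k0 kw (u := rcons u x) (v := v).
    have {le} := le; rewrite cat_rcons leq_eqVlt => /(_ Ew)/orP[/eqP e|//].
    have ms i : mstat w i (size v) = count_mem (i, false) v.
      by rewrite Ew -cat_rcons mstat_suffix.
    have := Ha (size v); rewrite !ms e Ew size_cat /= addnS ltnS leq_addl.
    rewrite subSn ?leq_addl // addnK nth_cat ltnn subnn /= => /(_ isT erefl).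
    by rewrite !inE !ltnn /=; case: x xk {Ew ms} => i [] /= ->; rewrite eqxx ?orbT.
  move=> xk; have := k_amenable_prefix k0 kw Ew.
  rewrite leq_eqVlt => /orP[/eqP e|//].
  have ms i : mstat w i (size w + size u) =
    count_mem (i, false) w + count_mem (i, true) u.
    by rewrite {1 2}Ew mstat_prefix -Ew.
  have := Hb (size w + size u); rewrite !ms e.
  have -> : size w <= size w + size u < (size w).*2.
    by rewrite Ew size_cat /=; lia.
  rewrite addKn {1}(_ : nth _ w _ = x) ?xk => [/(_ isT erefl) //|].
  by rewrite Ew nth_cat ltnn subnn.
split=> // j Hj.
  (* The zero-based position of the letter tested in the first scan; exactly [j] letters follow
     it. *)
  set p := (size w - j).-1; have pw : p < size w by lia.
  have Ew : w = take p w ++ nth (0, false) w p :: drop p.+1 w.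
    by rewrite -drop_nth ?cat_take_drop.
  have Ej : j = size (drop p.+1 w) by rewrite size_drop /p; lia.
  have ms i : mstat w i j = count_mem (i, false) (drop p.+1 w).
    by rewrite {1}Ew -cat_rcons Ej mstat_suffix.
  rewrite !ms => e; apply/negP => xk.
  have := Ha _ _ _ Ew; rewrite e ltnn => H; suff: false by [].
  by apply: H; move: xk; rewrite !inE => /orP[] /eqP ->.
(* In the second scan [p] letters precede the tested one. *)
set p := j - size w; have pw : p < size w by lia.
have Ew : w = take p w ++ nth (0, false) w p :: drop p.+1 w.
  by rewrite -drop_nth ?cat_take_drop.
have Ej : j = size w + size (take p w) by rewrite size_take pw /p; lia.
have ms i : mstat w i j = count_mem (i, false) w + count_mem (i, true) (take p w).
  have := mstat_prefix (take p w) (nth (0, false) w p :: drop p.+1 w) i.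
  by rewrite -Ew -Ej.
by rewrite !ms => e; apply/negP => xk; have := Hb _ _ _ Ew xk; rewrite e ltnn.
Qed.

(** * Amenability as a condition on sets of boxes ordered by reading *)

Section OrderedBoxes.
Variables (I : finType) (T : I -> letter) (r : rel I).
Hypotheses (r_total : total r) (r_trans : transitive r) (r_anti : antisymmetric r).

Let s := sort r (enum I).
Let w := map T s.

Lemma count_sort (P : pred I) : count P s = #|[set d | P d]|.
Proof.
rewrite cardsE cardE /(enum P) -enumT size_filter.
exact: (permP (permEl (perm_sort r _))).
Qed.

(** The sorted list has no repetitions and [r] is antisymmetric, so the order alone decides which
    boxes stand before and after [c]. *)
Lemma count_sort_split s1 c s2 (Q : pred I) : s = s1 ++ c :: s2 ->
  (count Q s2 = #|[set d | ~~ r d c & Q d]|) *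
  (count Q s1 = #|[set d | ~~ r c d & Q d]|).
Proof.
move=> Es; have us : uniq s by rewrite sort_uniq enum_uniq.
have : pairwise r s by rewrite -sorted_pairwise // sort_sorted.
rewrite Es pairwise_cat /= => /and4P[lt12 _ /allP c2 _].
have {lt12} c1 : {in s1, forall d, r d c}.
  by move=> d /(allrelP lt12); apply; rewrite inE eqxx.
move: us; rewrite Es cat_uniq /= negb_or => /and4P[_ /andP[c1N _] c2N _].
have n1 : {in s1, forall d, r c d = false}.
  move=> d d1; apply/negP => h; move: c1N; rewrite (r_anti (x:=c) (y:=d)) ?d1 //.
  by rewrite h c1.
have n2 : {in s2, forall d, r d c = false}.
  move=> d d2; apply/negP => h; move: c2N; rewrite (r_anti (x:=c) (y:=d)) ?d2 //.
  by rewrite h c2.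
have rr : r c c by case/orP: (r_total c c).
rewrite -!count_sort Es !count_cat /= rr /= !add0n.
split.
  rewrite (@eq_in_count _ _ pred0 s1) ?count_pred0 //; last first.
    by move=> d /c1 /= ->.
  by apply: eq_in_count => d /n2 /= ->.
rewrite (@eq_in_count _ _ pred0 s2) ?count_pred0 ?addn0 //; last first.
  by move=> d /c2 /= ->.
by apply: eq_in_count => d /n1 /= ->.
Qed.

(** The two scan conditions without a word: [~~ r d c] says that [d] stands after [c], and
    [~~ r c d] that it stands before. Two reading orders on the same boxes can then be compared by
    inclusions of sets. *)
Definition box_amenable k :=
  (forall c, (T c).1 = k ->
     #|[set d | ~~ r d c & T d == (k, false)]| <
     #|[set d | ~~ r d c & T d == (k.-1, false)]|) /\
  (forall c, T c \in [:: (k.-1, false); (k, true)] ->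
     #|[set d | T d == (k, false)]| + #|[set d | ~~ r c d & T d == (k, true)]| <
     #|[set d | T d == (k.-1, false)]| +
     #|[set d | ~~ r c d & T d == (k.-1, true)]|).

Lemma sort_split c : s = take (index c s) s ++ c :: drop (index c s).+1 s.
Proof.
have cs : c \in s by rewrite mem_sort mem_enum.
by rewrite -[X in _ ++ X :: _](nth_index c cs) -drop_nth ?index_mem // cat_take_drop.
Qed.

Lemma map_sort_split u x v : w = u ++ x :: v ->
  exists s1 c s2, [/\ s = s1 ++ c :: s2, u = map T s1, x = T c & v = map T s2].
Proof.
move=> Ew; have lt : size u < size s.
  by rewrite -(size_map T) -/w Ew size_cat /=; lia.
have [c0 _] : exists c0, c0 \in s by case: s lt => // c0 ? _; exists c0; rewrite mem_head.
exists (take (size u) s), (nth c0 s (size u)), (drop (size u).+1 s).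
rewrite -drop_nth // cat_take_drop map_take map_drop -/w -(nth_map _ x) // -/w Ew.
rewrite take_size_cat // nth_cat ltnn subnn -cat_rcons.
by rewrite -(size_rcons u x) drop_size_cat.
Qed.

Lemma k_amenable_box k : 0 < k ->
  k_amenable w k <->
  [/\ box_amenable k, leftmost_unmarked w k & leftmost_unmarked w k.-1].
Proof.
move=> k0; rewrite k_amenableP //; split=> [[Ha Hb Hc Hd]|[[Ha Hb] Hc Hd]]; split=> //.
- split=> c Tc; have Es := sort_split c; have Ew := congr1 (map T) Es;
    rewrite map_cat in Ew.
    have := Ha _ _ _ Ew Tc.
    by rewrite !count_map !(count_sort_split _ Es).
  have := Hb _ _ _ Ew Tc.
  by rewrite !count_map !(count_sort_split _ Es) -/s !count_sort.
- move=> _ _ _ /map_sort_split[s1 [c [s2 [Es _ -> ->]]]] /Ha.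
  by rewrite !count_map !(count_sort_split _ Es).
- move=> _ _ _ /map_sort_split[s1 [c [s2 [Es -> -> _]]]] /Hb.
  by rewrite !count_map !(count_sort_split _ Es) -/s !count_sort.
Qed.

Lemma k_amenable_after k : 0 < k -> k_amenable w k -> forall c,
  #|[set d | ~~ r d c & T d == (k, false)]| <=
  #|[set d | ~~ r d c & T d == (k.-1, false)]|.
Proof.
move=> k0 kw c; have Es := sort_split c.
have := k_amenable_suffix k0 kw (u := map T (rcons (take (index c s) s) c)).
move=> /(_ (map T (drop (index c s).+1 s))); rewrite -map_cat cat_rcons -Es.
by move=> /(_ erefl); rewrite !count_map !(count_sort_split _ Es).
Qed.
End OrderedBoxes.

(** * The orders on letters and on boxes *)

Lemma letter_le_trans : transitive letter_le.
Proof.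
move=> [j q] [i p] [k r]; rewrite /letter_le /=.
case/orP=> [ij|/andP[/eqP -> pq]]; case/orP=> [jk|/andP[/eqP <- qr]].
- by rewrite (ltn_trans ij jk).
- by rewrite ij.
- by rewrite jk.
- by rewrite eqxx ltnn /=; case: p q r pq qr => [] [] [].
Qed.

Lemma letter_le_index x y : letter_le x y -> x.1 <= y.1.
Proof. by rewrite /letter_le; case/orP => [/ltnW //|/andP[/eqP ->]]. Qed.

Lemma reading_le_total : total reading_le.
Proof. by move=> [i j] [k l]; rewrite /reading_le /=; lia. Qed.

Lemma reading_le_trans : transitive reading_le.
Proof. by move=> [i j] [k l] [m n]; rewrite /reading_le /=; lia. Qed.

Lemma reading_le_anti : antisymmetric reading_le.
Proof.
move=> [i j] [k l]; rewrite /reading_le /= => h.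
have [-> ->] : i = k /\ j = l by lia.
by [].
Qed.

(** * Fillings of movable boxes, and the shift to the right *)

Definition down (b : nat) (c : box) : box := (c.1 + (c.2 < b), c.2).
Definition right (a : nat) (c : box) : box := (c.1, c.2 + (c.1 < a)).

(** Boxes are indexed by a finite type and placed by [p], so that a shift changes [p] and keeps
    [T]. *)
Definition tableau_on (I : finType) (p : I -> box) (T : I -> letter) : Prop :=
  [/\ forall c, 0 < (T c).1,
      forall c d, (p c).1 = (p d).1 -> (p c).2 <= (p d).2 -> letter_le (T c) (T d),
      forall c d, (p c).2 = (p d).2 -> (p c).1 <= (p d).1 -> letter_le (T c) (T d),
      forall k c d, (p c).2 = (p d).2 ->
        T c = (k, false) -> T d = (k, false) -> c = d &
      forall k c d, (p c).1 = (p d).1 ->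
        T c = (k, true) -> T d = (k, true) -> c = d].

Definition word_on (I : finType) (p : I -> box) (T : I -> letter) : seq letter :=
  [seq T c | c <- sort (relpre p reading_le) (enum I)].

Section Shift.
Variables (I : finType) (p : I -> box) (T : I -> letter).
Hypothesis p_inj : injective p.
Hypothesis corner : forall c d, (p c).1 <= (p d).1 -> (p c).2 <= (p d).2 ->
  exists e, p e = ((p c).1, (p d).2).
Hypothesis tab : tableau_on p T.

(** Rows move as a whole, so only columns need an argument. Upper rows move at least as far as lower
    ones; hence of two boxes in one new column the upper one was weakly to the left, and the entry
    at the corner lies between theirs. *)
Lemma right_tableau a : tableau_on (right a \o p) T.
Proof.
have [T0 Tr Tc Tk Tk'] := tab; split=> //=.
- by move=> c d e le; apply: Tr => //; move: le; rewrite e; lia.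
- move=> c d e le; case: (leqP (p c).2 (p d).2) => h; last by lia.
  have [x px] := corner le h; apply: (@letter_le_trans (T x)).
    by apply: Tr; rewrite px.
  by apply: Tc; rewrite px.
- move=> k.
  suff H c d : (p c).1 <= (p d).1 ->
    (p c).2 + ((p c).1 < a) = (p d).2 + ((p d).1 < a) ->
    T c = (k, false) -> T d = (k, false) -> c = d.
    move=> c d e cT dT; case: (leqP (p c).1 (p d).1) => h; first exact: H.
    by apply/esym; apply: H => //; apply: ltnW.
  move=> le e cT dT; case: (leqP (p c).2 (p d).2) => h; last by lia.
  have [x px] := corner le h.
  have le1 : letter_le (T c) (T x) by apply: Tr; rewrite px.
  have le2 : letter_le (T x) (T d) by apply: Tc; rewrite px.
  (* Squeezed between two letters [k], the corner holds [k]; the column condition then identifies it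
     with [d], so [c] and [d] share a row. *)
  have xT : T x = (k, false).
    by move: le1 le2; rewrite cT dT /letter_le; case: (T x) => i [] /=;
    rewrite ?andbF ?andbT ?orbF => *; congr (_, _); lia.
  have xd : x = d by apply: (Tk k) => //; rewrite px.
  move: px; rewrite xd => pd; apply: p_inj.
  have h1 : (p d).1 = (p c).1 by rewrite {1}pd.
  rewrite [p c]surjective_pairing [p d]surjective_pairing h1.
  by congr (_, _); move: e; rewrite h1; lia.
Qed.

Lemma right_word a : word_on (right a \o p) T = word_on p T.
Proof.
rewrite /word_on; congr (map T (sort _ _)); apply/funext => c; apply/funext => d.
by rewrite /= /reading_le /=; lia.
Qed.

(** * The shift down: merged rows and the change of the reading order *)

Variable b : nat.

(* The boxes [u] and [v] belong to the same row after the shift but not before: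
   these are the pairs of boxes which the shift permutes in the reading order. *)
Definition swapped (u v : I) := ((p u).1.+1 == (p v).1) && ((p u).2 < b <= (p v).2).

(** The entry at the corner [x] lies between the two. Were all indices equal, a marked [x] would
    force a second marked letter at [u] in its row, and an unmarked [x] a second unmarked one at [v]
    in its column. *)
Lemma swapped_index u v : swapped u v -> (T u).1 < (T v).1.
Proof.
case/andP=> /eqP uv /andP[ub bv]; have [_ Tr Tc Tk Tk'] := tab.
have [||x px] := @corner u v; [lia|lia|].
have le1 : letter_le (T u) (T x) by apply: Tr; rewrite px //=; lia.
have le2 : letter_le (T x) (T v) by apply: Tc; rewrite px //=; lia.
have ux : u <> x by move=> e; move: px; rewrite -e; case: (p u) ub => ? ? /= ? []; lia.
have xv : x <> v by move=> e; move: px; rewrite e => /(congr1 fst) /=; lia.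
rewrite ltnNge; apply/negP => vu.
have e1 : (T u).1 = (T x).1.
  by have := letter_le_index le1; have := letter_le_index le2; lia.
have e2 : (T x).1 = (T v).1.
  by have := letter_le_index le1; have := letter_le_index le2; lia.
move: le1 le2; rewrite /letter_le e1 e2 ltnn eqxx /=.
case Eu: (T u) e1 => [i [|]]; case Ex: (T x) e2 => [j [|]];
  case Ev: (T v) => [l [|]] //= e2 e1.
- by move=> _ _; apply: ux; apply: (Tk' j); rewrite ?Ex ?Eu ?px -?e1.
- by move=> _ _; apply: ux; apply: (Tk' j); rewrite ?Ex ?Eu ?px -?e1.
- by move=> _ _; apply: xv; apply: (Tk j); rewrite ?Ex ?Ev ?px ?e2.
- by move=> _ _; apply: xv; apply: (Tk j); rewrite ?Ex ?Ev ?px ?e2.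
Qed.

Lemma down_row c d : (p c).1 + ((p c).2 < b) = (p d).1 + ((p d).2 < b) ->
  [\/ (p c).1 = (p d).1, swapped c d | swapped d c].
Proof.
move=> e; case: (ltngtP (p c).1 (p d).1) => h.
- by apply: Or32; rewrite /swapped; lia.
- by apply: Or33; rewrite /swapped; lia.
- exact: Or31.
Qed.

Lemma down_tableau : tableau_on (down b \o p) T.
Proof.
have [T0 Tr Tc Tk Tk'] := tab; split=> //=.
- move=> c d e le; case: (down_row e) => [/Tr ->//|/swapped_index|/andP[]]; last by lia.
  by rewrite /letter_le => ->.
- by move=> c d e le; apply: Tc => //; move: le; rewrite e; lia.
- move=> k c d e cT dT; case: (down_row e) => [h|/swapped_index|/swapped_index].
  + exact: (Tk' k).
  + by rewrite cT dT ltnn.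
  + by rewrite cT dT ltnn.
Qed.

Let r1 := relpre p reading_le.
Let r2 := relpre (down b \o p) reading_le.

Lemma r1_not_r2 c d : r1 c d -> ~~ r2 c d -> swapped d c.
Proof. by rewrite /r1 /r2 /swapped /reading_le /=; lia. Qed.

Lemma r2_not_r1 c d : r2 c d -> ~~ r1 c d -> swapped c d.
Proof. by rewrite /r1 /r2 /swapped /reading_le /=; lia. Qed.

Lemma down_inj : injective (down b).
Proof. by move=> [i j] [k l] [/[swap] ->] /addIn ->. Qed.

Lemma preim_total (q : I -> box) : total (relpre q reading_le).
Proof. by move=> c d; apply: reading_le_total. Qed.

Lemma preim_trans (q : I -> box) : transitive (relpre q reading_le).
Proof. by move=> c d e; apply: reading_le_trans. Qed.

Lemma preim_anti (q : I -> box) : injective q -> antisymmetric (relpre q reading_le).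
Proof. by move=> qi c d h; apply: qi; apply: reading_le_anti. Qed.

(** Swapped boxes carry different indices, so both orders agree on the boxes of index [k]. This
    carries over the conditions on leftmost letters. *)
Lemma down_filter k :
  [seq y <- word_on (down b \o p) T | y.1 == k] = [seq y <- word_on p T | y.1 == k].
Proof.
rewrite /word_on !filter_map; congr map.
rewrite !(filter_sort (@preim_total _) (@preim_trans _)).
set F := filter _ _.
apply: (sorted_eq (@preim_trans (down b \o p))).
- exact: preim_anti (inj_comp down_inj p_inj).
- exact/sort_sorted/preim_total.
- rewrite -(@eq_in_sorted _ [pred c | (T c).1 == k] (relpre p reading_le)).
  + exact/sort_sorted/preim_total.
  + move=> c d; rewrite !inE => /eqP ck /eqP dk.
    apply/idP/idP=> h; apply: contraT => n.
      by have := swapped_index (r1_not_r2 h n); rewrite ck dk ltnn.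
    by have := swapped_index (r2_not_r1 h n); rewrite ck dk ltnn.
  + by rewrite all_sort filter_all.
- by rewrite perm_sort perm_sym perm_sort.
Qed.

(** The box above [d] is the corner of [u] and [d], so its letter lies between [k-1] and that of
    [d]; an unmarked [k] there would repeat in the column. *)
Lemma up_letter k u c d : swapped u c -> T u = (k.-1, false) -> (T d).1 = k ->
  (p d).1 = (p c).1 -> (p c).2 <= (p d).2 -> 0 < k ->
  exists e, [/\ p e = ((p d).1.-1, (p d).2), letter_le (T e) (T d) &
                T e \in [:: (k.-1, false); (k, true)]].
Proof.
move=> /andP[/eqP uc /andP[ub bc]] uT dT dc cd k0.
have [_ Tr Tc Tk Tk'] := tab.
have [||x px] := @corner u d; [lia|lia|].
have le1 : letter_le (T u) (T x) by apply: Tr; rewrite px //=; lia.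
have le2 : letter_le (T x) (T d) by apply: Tc; rewrite px //=; lia.
exists x; split=> //; first by rewrite px; congr (_, _); lia.
have xd : x <> d by move=> e; move: px; rewrite e => /(congr1 fst) /=; lia.
move: le1 le2; rewrite /letter_le uT; case Ed: (T d) dT => [kd bd] /= kdk; rewrite kdk.
case Ex: (T x) => [i m] /=; rewrite !inE !xpair_eqE !(eqb_id, eqbF_neg).
case: m Ex => Ex le1 le2; rewrite /= ?andbT ?andbF ?orbF in le1 le2 *; first by lia.
have nb : ~~ ((i == k) && ~~ bd).
  apply/negP => /andP[/eqP ik /negPf bd0].
  by apply: xd; apply: (Tk k); rewrite ?px ?Ex ?ik ?Ed ?bd0 // -kdk.
by case: bd nb le2 {Ed}; rewrite /= ?andbT ?andbF ?orbF; lia.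
Qed.

(* Every [k'] or [k] weakly to the right of [c] in its row lies below a [k-1] or
   a [k'], and all but the last of them lie below a [k-1].  These [k-1]'s make up
   for the [k-1] of [u], which is not read before [c] any more. *)
Lemma down_after_swapped k u c : 0 < k -> k_amenable (word_on p T) k ->
  swapped u c -> T u = (k.-1, false) -> (T c).1 = k ->
  #|[set d | ~~ r2 d c & T d == (k, false)]| <
  #|[set d | ~~ r2 d c & T d == (k.-1, false)]|.
Proof.
move=> k0 kw uc uT cT; have [T0 Tr Tc Tk Tk'] := tab.
have /andP[/eqP ruc /andP[ub bc]] := uc.
have r1_anti : antisymmetric r1 by apply: preim_anti.
have weak := k_amenable_after (@preim_total p) (@preim_trans p) r1_anti k0 kw.
have [[strict _] _ _] :=
  (k_amenable_box T (@preim_total p) (@preim_trans p) r1_anti k0).1 kw.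
pose Y := [set d | ((p d).1 == (p c).1) &&
             ((d == c) || ((p c).2 < (p d).2) && (T d == (k, false)))].
have cY : c \in Y by rewrite inE !eqxx.
have YP d : d \in Y -> [/\ (p d).1 = (p c).1, (p c).2 <= (p d).2 & (T d).1 = k].
  by rewrite inE => /andP[/eqP ->] /orP[/eqP ->|/andP[/ltnW ? /eqP ->]].
(* The box above [d]; it exists for all [d] in [Y], so the default [d] is never taken there. *)
pose up d := odflt d [pick e | p e == ((p d).1.-1, (p d).2)].
have upP d : d \in Y -> [/\ p (up d) = ((p d).1.-1, (p d).2),
    letter_le (T (up d)) (T d) & T (up d) \in [:: (k.-1, false); (k, true)]].
  move=> /YP[rd cd dT]; have [e [pe le eT]] := up_letter uc uT dT rd cd k0.
  suff -> : up d = e by [].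
  rewrite /up; case: pickP => [x /eqP px|/(_ e)]; last by rewrite pe eqxx.
  by apply: p_inj; rewrite px pe.
have [z zY zmax] : exists2 z, z \in Y & forall d, d \in Y -> (p d).2 <= (p z).2.
  by case: (arg_maxnP (fun d => (p d).2) cY) => z; exists z.
have [pz lez zT] := upP _ zY; have [rz cz Tz] := YP _ zY.
(* A [k'] above [d] would force [k'] above the rightmost box [z] too, hence two in one row. *)
have upT d : d \in Y -> d != z -> T (up d) = (k.-1, false) /\ (p d).2 < (p z).2.
  move=> dY dz; have [pd led] := upP _ dY; have [rd cd Td] := YP _ dY.
  have lt : (p d).2 < (p z).2.
    rewrite ltn_neqAle zmax // andbT; apply: contra_neq dz => e; apply: p_inj.
    by rewrite [p d]surjective_pairing rd e -rz -surjective_pairing.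
  rewrite !inE => /orP[/eqP //|/eqP dT]; split=> //; exfalso.
  have : letter_le (T (up d)) (T (up z)).
    by apply: Tr; rewrite pd pz ?rd ?rz //= ltnW.
  move: zT; rewrite !inE dT => /orP[/eqP ->|/eqP zT]; first by rewrite /letter_le /=; lia.
  move=> _; have e : up d = up z by apply: (Tk' k); rewrite // pd pz /= rd rz.
  by move: pd; rewrite e pz => -[_ e2]; rewrite e2 ltnn in lt.
pose A l := [set d | ~~ r1 d (up z) & T d == l].
(* A [k] read after [c] in the new order is in the row of [c], or comes after [up z] in the old
   order: elsewhere it would lie weakly left of [up z] in that row, whose letter is smaller than
   [k]. *)
have upper : #|[set d | ~~ r2 d c & T d == (k, false)]| <= #|Y :\ c| + #|A (k, false)|.
  apply: leq_trans (leq_card_setU _ _); apply/subset_leq_card/fintype.subsetP => d.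
  rewrite !inE => /andP[dc /eqP dT]; rewrite dT eqxx !andbT.
  case: (boolP (reading_le (p d) (p (up z)))) => [dz|]; last by rewrite orbT.
  rewrite orbF.
  rewrite /reading_le /= in dc.
  have dnc : d != c.
    by apply: contraNneq dc => ->; lia.
  rewrite dnc /=; rewrite /reading_le pz /= in dz.
  have [e|ne] := eqVneq (p d).1 (p c).1; first by lia.
  exfalso; have rd : (p d).1 = (p (up z)).1 by rewrite pz /=; lia.
  have := Tr d (up z) rd; rewrite dT {1}pz /=.
  move: zT; rewrite !inE => /orP[] /eqP ->; rewrite /letter_le /=; lia.
(* The boxes above [Z] are not after [up z], so they are disjoint from [A (k.-1, false)]; both sets
   stay after [c]. *)
have lower (Z : {set I}) : Z \subset Y ->
    (forall d, d \in Z -> T (up d) = (k.-1, false)) ->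
    #|Z| + #|A (k.-1, false)| <= #|[set d | ~~ r2 d c & T d == (k.-1, false)]|.
  move=> /fintype.subsetP ZY ZT.
  have upi : {in Z &, injective up}.
    move=> d e /ZY dY /ZY eY ude; have [pd _ _] := upP _ dY; have [pe _ _] := upP _ eY.
    have [rd _ _] := YP _ dY; have [re _ _] := YP _ eY.
    move: pd; rewrite ude pe => -[_ ce]; apply: p_inj.
    by rewrite [p d]surjective_pairing rd -re -ce -surjective_pairing.
  rewrite -(card_in_imset upi) -cardsUI [X in _ + X]eq_card0; last first.
    move=> x; rewrite !inE; apply/negP => /andP[/imsetP[d dZ ->]].
    have [pd _ _] := upP _ (ZY _ dZ); have [rd _ _] := YP _ (ZY _ dZ).
    by have := zmax _ (ZY _ dZ); rewrite /= /reading_le pd pz rd rz /= ltnn eqxx /= => ->.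
  rewrite addn0; apply/subset_leq_card/fintype.subsetP => x.
  rewrite finset.in_setU => /orP[/imsetP[d dZ ->]|].
    have [pd _ _] := upP _ (ZY _ dZ); have [rd cd _] := YP _ (ZY _ dZ).
    by rewrite inE ZT // eqxx andbT /= /reading_le pd /=; lia.
  rewrite !inE => /andP[xz ->]; rewrite andbT; move: xz.
  by rewrite /= /reading_le pz /=; lia.
(* If [k-1] stands above [z], the weak inequality after [up z] suffices. If [k'] stands there, [z]
   must be dropped from [Y], and strictness at [up z] repays the loss. *)
have {}lower : #|Y| + #|A (k, false)| <= #|[set d | ~~ r2 d c & T d == (k.-1, false)]|.
  move: (zT); rewrite !inE => /orP[] /eqP zTE.
    apply: leq_trans (lower Y (subxx _) _); first by rewrite leq_add2l weak.
    by move=> d dY; have [-> //|/upT[]] := eqVneq d z.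
  apply: leq_trans (lower (Y :\ z) (subD1set _ _) _).
    rewrite (cardsD1 z Y) zY add1n addSn -addnS leq_add2l.
    by apply: strict; rewrite zTE.
  by move=> d; rewrite !inE -/Y => /andP[dz dY]; have [] := upT d _ dz; rewrite ?inE.
apply: leq_trans lower; rewrite (cardsD1 c Y) cY add1n addSn ltnS.
exact: upper.
Qed.

Lemma down_k_amenable k : 0 < k -> k_amenable (word_on p T) k ->
  k_amenable (word_on (down b \o p) T) k.
Proof.
move=> k0 kw; have r1_anti : antisymmetric r1 by apply: preim_anti.
have r2_anti : antisymmetric r2 by apply/preim_anti/inj_comp/p_inj/down_inj.
have [[Ha Hb] Hc Hd] :=
  (k_amenable_box T (@preim_total p) (@preim_trans p) r1_anti k0).1 kw.
apply/(k_amenable_box T (@preim_total _) (@preim_trans _) r2_anti k0).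
rewrite /leftmost_unmarked -/(word_on _ T) !down_filter; split=> //; split=> c cT.
  have [/existsP[u /andP[uc /eqP uT]]|no_u] :=
    boolP [exists u, swapped u c && (T u == (k.-1, false))].
    exact: down_after_swapped k0 kw uc uT cT.
  (* With no such [u], the set of [k-1] after [c] loses nothing, and the set of [k] gains nothing
     because equal indices are never swapped. *)
  apply: leq_ltn_trans (leq_trans (Ha c cT) _); apply/subset_leq_card/fintype.subsetP => d.
    rewrite !inE => /andP[dc /eqP dT]; rewrite dT eqxx andbT.
    apply: contra dc => dc; apply: contraT => n.
    by have := swapped_index (r1_not_r2 dc n); rewrite cT dT ltnn.
  rewrite !inE => /andP[dc dT]; rewrite dT andbT; apply: contra dc => dc.
  apply: contraT => n; case/negP: no_u; apply/existsP; exists d.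
  by rewrite dT (r2_not_r1 dc n).
(* In the second scan, a new [k'] before [c] would need an index above [k] at [c], and a lost
   [(k-1)'] an index below [k-1]. *)
have ck : k.-1 <= (T c).1 <= k.
  by move: cT; rewrite !inE => /orP[] /eqP -> /=; lia.
apply: leq_ltn_trans (leq_trans (Hb c cT) _); rewrite leq_add2l;
  apply/subset_leq_card/fintype.subsetP => d; rewrite !inE => /andP[dc dT];
  rewrite dT andbT; apply: contra dc => dc; apply: contraT => n.
- by have := swapped_index (r1_not_r2 dc n); rewrite (eqP dT) /=; lia.
- by have := swapped_index (r2_not_r1 dc n); rewrite (eqP dT) /=; lia.
Qed.
End Shift.

(** * Corners in skew shifted diagrams *)

Lemma mem_diagram (la : seq nat) (c : box) :
  (c \in diagram la) = (0 < c.1 <= size la) && (c.1 <= c.2 < c.1 + nth 0 la c.1.-1).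
Proof.
case: c => x y /=; apply/allpairsPdep/idP => [[i [j []]]|h].
  by rewrite !mem_iota => hi hj [-> ->] /=; lia.
exists x.-1, (y - x); rewrite !mem_iota; split; [lia|lia|].
by congr (_, _); lia.
Qed.

(** Each part drops by at least one, which offsets the indentation: the right ends of the rows of a
    shifted diagram never move right on the way down. *)
Lemma addn_nth_sorted_gtn (la : seq nat) i j : sorted gtn la -> i <= j < size la ->
  j + nth 0 la j <= i + nth 0 la i.
Proof.
move=> /(sortedP 0) s /andP[]; elim: j => [|j IH]; first by rewrite leqn0 => /eqP ->.
rewrite leq_eqVlt => /predU1P[-> //|ij] js.
by have := IH ij (ltnW js); have := s _ js; rewrite /=; lia.
Qed.

(** The row of [c] in the outer diagram reaches at least as far as that of [d], and in the inner
    diagram it ends before [c]. *)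
Lemma skew_corner (la mu : seq nat) (c d : seq_sub (skew la mu)) : sorted gtn la ->
  (val c).1 <= (val d).1 -> (val c).2 <= (val d).2 ->
  exists e : seq_sub (skew la mu), val e = ((val c).1, (val d).2).
Proof.
move=> sla; have := valP c; have := valP d.
case: (val c) (val d) => [x y] [x' y'] /=.
rewrite !mem_filter !mem_diagram /= => /andP[_ d_la] /andP[c_mu c_la] xx yy.
have e_in : (x, y') \in skew la mu.
  rewrite mem_filter !mem_diagram /=; apply/andP; split.
    by move: c_mu; lia.
  by have := @addn_nth_sorted_gtn la x.-1 x'.-1 sla; lia.
by exists (SeqSub e_in).
Qed.

(** * Transport of tableaux to the translated shape *)

Lemma content_perm (D E : seq box) (S : filling D) (T : filling E) :
  perm_eq (reading_word S) (reading_word T) -> content S = content T.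
Proof.
move=> ST; rewrite /content (perm_big _ ST) /=; apply: eq_mkseq => i.
exact: permP.
Qed.

Lemma leq_translate (x y x' y' : nat) (t : int) :
  (x%:Z = y%:Z + t)%R -> (x'%:Z = y'%:Z + t)%R -> (x <= x') = (y <= y').
Proof. by move=> h h'; lia. Qed.

(** Undoing the translation and [phi] gives a bijection [g] from the boxes of [E] to those of [D].
    Composition with [g] maps amenable tableaux injectively and keeps the content. *)
Lemma card_amenable_shift (D E : seq box) (phi : box -> box) (t : int * int) nu :
    injective phi ->
    translate (0, 0)%R [seq phi c | c <- D] =i translate t E ->
    (forall T : filling D, is_tableau T -> tableau_on (phi \o val) T) ->
    (forall T : filling D, is_tableau T -> amenable (reading_word T) ->
       amenable (word_on (phi \o val) T)) ->
  #|` fset_set (@amenable_tableaux D nu)|%fset <=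
  #|` fset_set (@amenable_tableaux E nu)|%fset.
Proof.
move=> phi_inj DE shift_tab shift_amen.
have coord (e : seq_sub E) : exists d : seq_sub D,
    ((phi (val d)).1%:Z = (val e).1%:Z + t.1)%R /\
    ((phi (val d)).2%:Z = (val e).2%:Z + t.2)%R.
  have : ((val e).1%:Z + t.1, (val e).2%:Z + t.2)%R \in translate t E.
    by apply/mapP; exists (val e) => //; apply: valP.
  rewrite -DE => /mapP[_ /mapP[d dD ->] [-> ->]].
  by exists (SeqSub dD); rewrite !GRing.addr0.
have [g gP] := fin_all_exists coord.
have g1 e e' : ((phi (val (g e))).1 <= (phi (val (g e'))).1) = ((val e).1 <= (val e').1).
  by have [h _] := gP e; have [h' _] := gP e'; exact: leq_translate h h'.
have g2 e e' : ((phi (val (g e))).2 <= (phi (val (g e'))).2) = ((val e).2 <= (val e').2).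
  by have [_ h] := gP e; have [_ h'] := gP e'; exact: leq_translate h h'.
have g_inj : injective g.
  move=> e e' ee; apply/val_inj.
  rewrite [val e]surjective_pairing [val e']surjective_pairing; congr (_, _).
    by have := g1 e e'; have := g1 e' e; rewrite ee; lia.
  by have := g2 e e'; have := g2 e' e; rewrite ee; lia.
have g_surj d : exists e, g e = d.
  have : ((phi (val d)).1%:Z, (phi (val d)).2%:Z)%R \in translate (0, 0)%R [seq phi c | c <- D].
    apply/mapP; exists (phi (val d)); last by rewrite /= !GRing.addr0.
    exact/map_f/valP.
  rewrite DE => /mapP[e eE [h1 h2]]; exists (SeqSub eE).
  have [/= h1' h2'] := gP (SeqSub eE); apply/val_inj/phi_inj.
  have [r1] := etrans h1' (esym h1); have [r2] := etrans h2' (esym h2).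
  by rewrite [LHS]surjective_pairing [RHS]surjective_pairing r1 r2.
pose G (T : filling D) : filling E := [ffun e => T (g e)].
have G_inj : injective G.
  move=> S T ST; apply/ffunP => d; have [e <-] := g_surj d.
  by move/ffunP/(_ e): ST; rewrite !ffunE.
have G_word T : reading_word (G T) = word_on (phi \o val) T.
  rewrite /reading_word /word_on.
  (* Translations preserve comparisons of coordinates, so the reading order of [E] is the shifted
     order pulled back along [g]. *)
  have -> : (relpre val reading_le : rel (seq_sub E)) =
      relpre g (relpre (phi \o val) reading_le).
    apply/funext => e; apply/funext => e'; rewrite /= /reading_le.
    by rewrite !ltnNge !eqn_leq !g1 !g2.
  under eq_map do rewrite ffunE.
  rewrite (map_comp T g) -sort_map; congr map.
  apply/perm_sortP; [exact: preim_total|exact: preim_trans| |].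
    exact/preim_anti/inj_comp/val_inj/phi_inj.
  apply: uniq_perm; rewrite ?(map_inj_uniq g_inj) ?enum_uniq // => d.
  rewrite mem_enum; apply/mapP; have [e <-] := g_surj d.
  by exists e; rewrite ?mem_enum.
have G_amen T : (@amenable_tableaux D nu) T -> (@amenable_tableaux E nu) (G T).
  move=> [tabT amT cT]; have [T0 Tr Tc Tk Tk'] := shift_tab T tabT.
  split.
  - have eq1 e e' : (val e).1 = (val e').1 ->
        (phi (val (g e))).1 = (phi (val (g e'))).1.
      by move=> h; apply/eqP; rewrite eqn_leq !g1 h leqnn.
    have eq2 e e' : (val e).2 = (val e').2 ->
        (phi (val (g e))).2 = (phi (val (g e'))).2.
      by move=> h; apply/eqP; rewrite eqn_leq !g2 h leqnn.
    split=> [e|e e' /eq1 h le|e e' /eq2 h le|k e e' /eq2 h|k e e' /eq1 h];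
      rewrite !ffunE.
    + exact: T0.
    + by apply: Tr; rewrite //= g2.
    + by apply: Tc; rewrite //= g1.
    + by move=> h1 h2; apply/g_inj/(Tk k).
    + by move=> h1 h2; apply/g_inj/(Tk' k).
  - by rewrite G_word; apply: shift_amen.
  - rewrite -cT; apply: content_perm; rewrite G_word; apply: perm_map.
    by rewrite perm_sort perm_sym perm_sort.
set A := fset_set _; have <- : #|` [fset G T | T in A]|%fset = #|` A|%fset.
  by rewrite card_imfset.
apply/fsubset_leq_card/fsubsetP => _ /imfsetP[T /= TA ->].
move: TA; rewrite /A !in_fset_set; [|exact: finite_amenable_tableaux..].
by rewrite !inE => /G_amen.
Qed.

(** * The two inequalities for the coefficients *)

Lemma fcoef_shift_right la mu a al be nu : sorted gtn la ->
  has_shape (shift_right a (skew la mu)) al be -> fcoef la mu nu <= fcoef al be nu.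
Proof.
move=> sla [_ [t ht]]; have cor c d := @skew_corner la mu c d sla.
apply: (@card_amenable_shift _ _ (right a) _ _ _ ht).
- by move=> [i j] [k l] [<-] /addIn ->.
- by move=> T tabT; exact: (right_tableau val_inj cor tabT).
- by move=> T _; rewrite (right_word val).
Qed.

Lemma fcoef_shift_down la mu b al be nu : sorted gtn la ->
  has_shape (shift_down b (skew la mu)) al be -> fcoef la mu nu <= fcoef al be nu.
Proof.
move=> sla [_ [t ht]]; have cor c d := @skew_corner la mu c d sla.
apply: (@card_amenable_shift _ _ (down b) _ _ _ ht).
- exact: down_inj.
- by move=> T tabT; exact: (down_tableau cor tabT).
- move=> T tabT am k k1.
  exact: (down_k_amenable val_inj cor tabT _ (ltnW k1) (am k k1)).
Qed.

Theorem lemma3p5 (la mu : seq nat) (hla : is_DP la) (hmu : is_DP mu)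
    (hsub : contained mu la)
    (a b : nat) (ha : 2 <= a <= size mu + 2) (hb : size la <= b)
    (al be al' be' : seq nat)
    (hal : is_DP al) (hbe : is_DP be) (hal' : is_DP al') (hbe' : is_DP be')
    (hright : has_shape (shift_right a (skew la mu)) al be)
    (hdown : has_shape (shift_down b (skew la mu)) al' be')
    (nu : seq nat) (hnu : is_DP nu) :
  fcoef la mu nu <= fcoef al be nu /\ fcoef la mu nu <= fcoef al' be' nu.
Proof.
have /andP[sla _] := hla.
by split; [apply: fcoef_shift_right sla hright|apply: fcoef_shift_down sla hdown].
Qed.
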